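(* Let $n\geq 1$. Let $\mathcal{C}$ be the class of all expansions $(\mathbb{R}^n,\beta,P)$ of $(\mathbb{R}^n,\beta)$ by a unary predicate $P$, and let $\mathcal{F}\subseteq\mathcal{C}$ be the subclass of those structures in which $P$ is finite. Then $\mathcal{F}$ is first-order definable with respect to $\mathcal{C}$, i.e., there is a first-order $\{\beta,P\}$-sentence $\varphi$ such that for every $\mathfrak{M}\in\mathcal{C}$, $\mathfrak{M}\in\mathcal{F}$ iff $\mathfrak{M}\models\varphi$.
   Context: $\beta$ is the ternary Euclidean betweenness relation on $\mathbb{R}^n$: $\beta(s,t,u)$ holds iff $d(s,u)=d(s,t)+d(t,u)$, where $d$ is the Euclidean metric. *)

(* Defs.v *)
(* MathComp, with MathComp-Analysis for the real numbers and finite_set. *)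
From HB Require Import structures.
From mathcomp Require Import all_boot all_order all_algebra.
From mathcomp Require Import all_classical reals.

Set Implicit Arguments.
Unset Strict Implicit.
Unset Printing Implicit Defensive.

Import Order.TTheory GRing.Theory Num.Theory.

(* First-order logic with equality over the relational signature {beta, P},
   with beta ternary and P unary; variables are natural numbers. *)
Inductive formula : Type :=
| Fbot
| Feq (x y : nat)
| Fbeta (x y z : nat)
| FP (x : nat)
| Fnot (f : formula)
| Fand (f g : formula)
| For (f g : formula)
| Fimp (f g : formula)
| Fall (x : nat) (f : formula)
| Fex (x : nat) (f : formula).

Fixpoint free_vars (f : formula) : seq nat :=
  match f with
  | Fbot => [::]
  | Feq x y => [:: x; y]
  | Fbeta x y z => [:: x; y; z]
  | FP x => [:: x]
  | Fnot f => free_vars f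
  | Fand f g | For f g | Fimp f g => free_vars f ++ free_vars g
  | Fall x f | Fex x f => [seq y <- free_vars f | y != x]
  end.

Definition sentence (f : formula) : Prop := free_vars f = [::].

Record structure : Type := Structure {
  carrier : Type;
  beta_interp : carrier -> carrier -> carrier -> Prop;
  P_interp : set carrier
}.

Definition update (T : Type) (v : nat -> T) (x : nat) (a : T) : nat -> T :=
  fun y => if y == x then a else v y.

Fixpoint sat (M : structure) (v : nat -> carrier M) (f : formula) : Prop :=
  match f with
  | Fbot => False
  | Feq x y => v x = v y
  | Fbeta x y z => beta_interp (v x) (v y) (v z)
  | FP x => P_interp (v x)
  | Fnot f => ~ sat v f
  | Fand f g => sat v f /\ sat v g
  | For f g => sat v f \/ sat v g
  | Fimp f g => sat v f -> sat v g
  | Fall x f => forall a : carrier M, sat (update v x a) f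
  | Fex x f => exists a : carrier M, sat (update v x a) f
  end.

(* Quantifying over all valuations is the usual definition of truth for
   nonempty carriers, the only ones for which it is used. *)
Definition models (M : structure) (f : formula) : Prop :=
  forall v : nat -> carrier M, sat v f.

(* Classes are predicates rather than elements of (set structure), which would
   force the universe of carriers below that of the matrix types. *)
Definition fo_definable (F C : structure -> Prop) : Prop :=
  exists phi : formula, sentence phi /\
    forall M : structure, C M -> (F M <-> models M phi).

Local Open Scope ring_scope.

(* The library's norm on matrices is the sup norm, hence this definition. *)
Definition edist (R : realType) (n : nat) (x y : 'rV[R]_n) : R :=
  Num.sqrt (\sum_(i < n) (x 0 i - y 0 i) ^+ 2).

Definition ebetween (R : realType) (n : nat) (s t u : 'rV[R]_n) : Prop :=
  edist s u = edist s t + edist t u.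

Definition expansion (R : realType) (n : nat) (P : set 'rV[R]_n) : structure :=
  @Structure 'rV[R]_n (@ebetween R n) P.

Definition expansions (R : realType) (n : nat) : structure -> Prop :=
  fun M => exists P : set 'rV[R]_n, M = expansion P.

Definition finite_expansions (R : realType) (n : nat) : structure -> Prop :=
  fun M => expansions R n M /\ finite_set (@P_interp M).

(* Main.v *)
(* A subset P of R^n is finite iff it is bounded and every point c has a
   neighbourhood meeting P in at most c.  Both conditions can be expressed with
   hulls of c and 2n further points, a hull being obtained by iterating beta.
   Boundedness says that some hull contains P.  A hull H is a neighbourhood of
   c as soon as, towards every y <> c, it contains some z <> c of the segment
   [c, y], because H is convex and the dimension is finite; conversely the
   hulls of c and c +- r e_i are arbitrarily small neighbourhoods of c. *)
Require Import Defs.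
From mathcomp Require Import all_boot all_order all_algebra.
From mathcomp Require Import all_classical reals.
From mathcomp Require Import topology normedtype.
From mathcomp Require Import ring lra.

Set Implicit Arguments.
Unset Strict Implicit.
Unset Printing Implicit Defensive.

Import Order.TTheory GRing.Theory Num.Theory.
Import numFieldNormedType.Exports.

(** * Formulas for iterated hulls *)

Lemma update_eq (T : Type) (v : nat -> T) x a : update v x a x = a.
Proof. by rewrite /update eqxx. Qed.

Lemma update_neq (T : Type) (v : nat -> T) x a i :
  i != x -> update v x a i = v i.
Proof. by rewrite /update => /negPf ->. Qed.

(** Coning successively over the points of [l], starting from [c]; for Euclidean betweenness this is
    the convex hull of [c] and [l]. *)
Fixpoint iter_hull (T : Type) (b : T -> T -> T -> Prop) (c : T) (l : seq T)
    (x : T) : Prop :=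
  if l is a :: l' then exists y, iter_hull b c l' y /\ b y x a else x = c.

(* The bound variables are x+1, x+2, ..., so c and l must lie below x. *)
Fixpoint hull_formula (c : nat) (l : seq nat) (x : nat) : formula :=
  if l is a :: l' then
    Fex x.+1 (Fand (hull_formula c l' x.+1) (Fbeta x.+1 x a))
  else Feq x c.

(** The hypothesis on [c :: l] prevents the bound variables [x.+1], [x.+2], ... from capturing a
    parameter. *)
Lemma sat_hull_formula (M : structure) (v : nat -> carrier M) c l x :
  {in c :: l, forall i, i < x} ->
  sat v (hull_formula c l x) <->
  iter_hull (@beta_interp M) (v c) (map v l) (v x).
Proof.
elim: l x v => [|a l IH] x v lt_x //=.
have upd y i : i <= x -> update v x.+1 y i = v i.
  by move=> ix; rewrite update_neq // neq_ltn ltnS ix.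
have ltS : {in c :: l, forall i, i < x.+1}.
  move=> i il; apply: leqW; apply: lt_x.
  by move: il; rewrite !inE => /orP[->//|->]; rewrite !orbT.
have E y : [/\ update v x.+1 y x.+1 = y, update v x.+1 y x = v x,
    update v x.+1 y a = v a, update v x.+1 y c = v c
    & map (update v x.+1 y) l = map v l].
  have cx := lt_x c (mem_head _ _).
  have ax : a < x by apply: lt_x; rewrite !inE eqxx orbT.
  split; rewrite ?update_eq ?(upd _ _ (leqnn x)) ?(upd _ _ (ltnW ax)) //.
    by rewrite upd // ltnW.
  by apply/eq_in_map => i il; rewrite upd // -ltnS ltS // inE il orbT.
split=> -[y [h b]]; exists y; have [E1 E2 E3 E4 E5] := E y.
- move/(IH _ _ ltS): h; rewrite E1 E4 E5 => h; split=> //.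
  by move: b; rewrite E1 E2 E3.
- split; last by rewrite E1 E2 E3.
  by apply/(IH _ _ ltS); rewrite E1 E4 E5.
Qed.

(** First-order logic cannot quantify over lists, so a list of [m] points is encoded by the
    variables below [m]. *)
Definition exists_below (m : nat) (f : formula) : formula :=
  foldr Fex f (iota 0 m).

Lemma sat_foldr_Fex (M : structure) (v : nat -> carrier M) (s : seq nat) f :
  sat v (foldr Fex f s) <->
  exists w, (forall i, i \notin s -> w i = v i) /\ sat w f.
Proof.
elim: s v => [|x s IH] v /=.
  split=> [h|[w [e h]]]; first by exists v.
  by have -> : v = w by apply/funext => i; rewrite e.
split=> [[a /IH[w [e h]]]|[w [e h]]].
  exists w; split=> // i; rewrite inE negb_or => /andP[/negPf ix il].
  by rewrite e // /update ix.
exists (w x); apply/IH; exists w; split=> // i il; rewrite /update.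
by case: eqP => [->//|/eqP ix]; rewrite e // inE negb_or ix.
Qed.

Lemma sat_exists_below (M : structure) (v : nat -> carrier M) m f :
  sat v (exists_below m f) <->
  exists w, (forall i, m <= i -> w i = v i) /\ sat w f.
Proof.
split=> [/sat_foldr_Fex|] [w [e h]]; last (apply/sat_foldr_Fex);
  exists w; split=> // i im; apply: e; move: im; rewrite mem_iota add0n.
- by rewrite leqNgt.
- by rewrite -leqNgt.
Qed.

(** Truth in a structure already ranges over all valuations, so closing a formula preserves it and
    yields a sentence without computing the free variables of a concrete formula. *)
Definition universal_closure (f : formula) : formula :=
  foldr Fall f (free_vars f).

Lemma universal_closure_sentence f : sentence (universal_closure f).
Proof.
have E s : free_vars (foldr Fall f s) = [seq y <- free_vars f | y \notin s].
  elim: s => [|x s IH] /=; first by rewrite filter_predT.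
  rewrite IH -filter_predI; apply: eq_filter => y /=.
  by rewrite inE negb_or.
rewrite /sentence E -(filter_pred0 (free_vars f)).
by apply: eq_in_filter => y ->.
Qed.

Lemma models_universal_closure M f :
  models M (universal_closure f) <-> models M f.
Proof.
rewrite /universal_closure; elim: (free_vars f) => //= x s <-.
split=> h v; last by move=> a; exact: h.
(* Updating [v] at [x] by its own value gives [v] back. *)
have := h v (v x); congr sat; apply/funext => i.
by rewrite /update; case: eqP => // ->.
Qed.

(* Below, variable m is the centre of the hull, variables 0, ..., m-1 are its
   other generators, and m+1, m+2 are the points tested for membership. *)
Definition bounded_formula (m : nat) : formula :=
  Fex m (exists_below m
    (Fall m.+1 (Fimp (FP m.+1) (hull_formula m (iota 0 m) m.+1)))).

Definition isolated_formula (m : nat) : formula :=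
  Fall m (exists_below m (Fand
    (Fall m.+1 (Fimp (Fnot (Feq m.+1 m))
      (Fex m.+2 (Fand (Fnot (Feq m.+2 m))
        (Fand (Fbeta m m.+2 m.+1) (hull_formula m (iota 0 m) m.+2))))))
    (Fall m.+1 (Fimp (Fand (FP m.+1) (hull_formula m (iota 0 m) m.+1))
      (Feq m.+1 m))))).

Lemma sat_hull_formula_iota (M : structure) (v : nat -> carrier M) m x
    (l : seq (carrier M)) :
  m < x -> map v (iota 0 m) = l ->
  sat v (hull_formula m (iota 0 m) x) <->
  iter_hull (@beta_interp M) (v m) l (v x).
Proof.
move=> mx <-; apply: sat_hull_formula => i; rewrite inE mem_iota add0n.
by case/orP => [/eqP->//|/ltn_trans]; apply.
Qed.

Lemma map_update_iota (T : Type) (v : nat -> T) m x a :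
  m <= x -> map (update v x a) (iota 0 m) = map v (iota 0 m).
Proof.
move=> mx; apply/eq_in_map => i; rewrite mem_iota add0n => /andP[_ im].
by rewrite update_neq // neq_ltn (leq_trans im mx).
Qed.

Lemma valuation_of_seq (T : Type) (v : nat -> T) (l : seq T) :
  exists w, (forall i, size l <= i -> w i = v i) /\
    map w (iota 0 (size l)) = l.
Proof.
(* The default [v i] makes the new valuation fall back to [v] beyond the end of [l]. *)
exists (fun i => nth (v i) l i); split=> [i li|]; first by rewrite nth_default.
case: l => [//|a l]; rewrite -[RHS]take_size -(map_nth_iota0 a (leqnn _)).
apply/eq_in_map => i; rewrite mem_iota add0n => /andP[_ il].
exact: set_nth_default.
Qed.

Lemma sat_bounded_formula (M : structure) m (v : nat -> carrier M) :
  sat v (bounded_formula m) <->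
  exists c (l : seq (carrier M)), size l = m /\
    forall y, P_interp y -> iter_hull (@beta_interp M) c l y.
Proof.
split=> [[c /sat_exists_below[w [e h]]]|[c [l [sl h]]]].
  exists c, (map w (iota 0 m)); rewrite size_map size_iota; split=> // y Py.
  have := h y; rewrite /= update_eq => /(_ Py).
  move/(sat_hull_formula_iota (ltnSn m) (map_update_iota _ _ (leqnSn m))).
  by rewrite update_eq update_neq ?neq_ltn ?ltnSn // e // update_eq.
have [w [e wl]] := valuation_of_seq (update v m c) l; rewrite sl in e wl.
exists c; apply/sat_exists_below; exists w; split=> // y /=.
rewrite update_eq => /h hy.
apply/(sat_hull_formula_iota (ltnSn m) (map_update_iota _ _ (leqnSn m))).
by rewrite wl update_eq update_neq ?neq_ltn ?ltnSn // e // update_eq.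
Qed.

Lemma sat_isolated_formula (M : structure) m (v : nat -> carrier M) :
  sat v (isolated_formula m) <->
  forall c, exists l : seq (carrier M), [/\ size l = m,
    forall y, y <> c -> exists z, [/\ z <> c, beta_interp c z y
      & iter_hull (@beta_interp M) c l z]
    & forall y, P_interp y -> iter_hull (@beta_interp M) c l y -> y = c].
Proof.
have neq i : (m != m.+1 + i) by rewrite neq_ltn leq_addr.
have n1 := neq 0; have n2 := neq 1; rewrite ?addn0 ?addn1 in n1 n2.
have n12 : m.+1 != m.+2 by rewrite neq_ltn ltnSn.
have W (w : nat -> carrier M) c y : w m = c ->
    sat (update w m.+1 y) (hull_formula m (iota 0 m) m.+1) <->
    iter_hull (@beta_interp M) c (map w (iota 0 m)) y.
  move=> wc; apply: (iff_trans (sat_hull_formula_iota (ltnSn m)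
    (map_update_iota w y (leqnSn m)))).
  by rewrite update_eq update_neq // wc.
have W2 (w : nat -> carrier M) c y z : w m = c ->
    sat (update (update w m.+1 y) m.+2 z) (hull_formula m (iota 0 m) m.+2) <->
    iter_hull (@beta_interp M) c (map w (iota 0 m)) z.
  move=> wc; have mm : m <= m.+2 by rewrite leqW.
  apply: (iff_trans (sat_hull_formula_iota (leqW (ltnSn m))
    (map_update_iota (update w m.+1 y) z mm))).
  by rewrite map_update_iota // update_eq !update_neq // wc.
split=> [h c|h c].
  have /sat_exists_below[w [e [h1 h2]]] := h c.
  have wc : w m = c by rewrite e // update_eq.
  exists (map w (iota 0 m)); split; first by rewrite size_map size_iota.
    move=> y yc; have := h1 y; rewrite /= update_eq update_neq // wc.
    move=> /(_ yc)[z]; rewrite update_eq !(update_neq _ _ n2, update_neq _ _ n12).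
    rewrite update_eq (update_neq _ _ n1) wc.
    by move=> [zc [b /(W2 _ _ _ _ wc) hz]]; exists z.
  move=> y Py hy; have := h2 y; rewrite /= update_eq update_neq // wc.
  by apply; split=> //; apply/(W _ _ _ wc).
have [l [sl h1 h2]] := h c.
have [w [e wl]] := valuation_of_seq (update v m c) l; rewrite sl in e wl.
have wc : w m = c by rewrite e // update_eq.
apply/sat_exists_below; exists w; split=> //; split=> y /=.
  rewrite update_eq update_neq // wc => /h1[z [zc b hz]]; exists z.
  rewrite update_eq !(update_neq _ _ n2, update_neq _ _ n12).
  rewrite update_eq (update_neq _ _ n1) wc; split=> //; split=> //.
  by apply/(W2 _ _ _ _ wc); rewrite wl.
rewrite update_eq update_neq // wc => -[Py /(W _ _ _ wc)].
by rewrite wl; exact: h2.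
Qed.

(** * Euclidean betweenness and convexity of hulls *)

Local Open Scope ring_scope.
Local Open Scope classical_set_scope.

(** Betweenness is membership in a segment: squaring the equality of distances leads to the equality
    case of Cauchy-Schwarz, which makes [t - s] and [u - t] parallel with the same direction. *)
Lemma ebetweenP (R : realType) n (s t u : 'rV[R]_n) :
  ebetween s t u <-> exists2 r, 0 <= r <= 1 & t = s + r *: (u - s).
Proof.
rewrite /ebetween /Defs.edist; split; last first.
  move=> [r /andP[r0 r1] et].
  have {}et i : t 0 i = s 0 i + r * (u 0 i - s 0 i) by rewrite et !mxE.
  (* [E] shows that the distances from [s] to [t] and from [t] to [u] are [r] and [1 - r] times that
     from [s] to [u]. *)
  have E (q : R) (x y : 'rV[R]_n) : 0 <= q ->
      (forall i, x 0 i - y 0 i = q * (s 0 i - u 0 i)) ->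
      Num.sqrt (\sum_(i < n) (x 0 i - y 0 i) ^+ 2) =
      q * Num.sqrt (\sum_(i < n) (s 0 i - u 0 i) ^+ 2).
    move=> q0 xy; under eq_bigr do rewrite xy exprMn.
    by rewrite -mulr_sumr sqrtrM ?sqr_ge0 // sqrtr_sqr ger0_norm.
  have -> := E r s t r0; last by move=> i; rewrite et; ring.
  have -> := E (1 - r) t u; first by ring.
    by rewrite subr_ge0.
  by move=> i; rewrite et; ring.
set A := \sum_(i < n) (s 0 i - t 0 i) ^+ 2.
set B := \sum_(i < n) (t 0 i - u 0 i) ^+ 2.
pose D := \sum_(i < n) (s 0 i - t 0 i) * (t 0 i - u 0 i).
have sE : \sum_(i < n) (s 0 i - u 0 i) ^+ 2 = A + 2 * D + B.
  by rewrite /A /B /D mulr_sumr -!big_split /=; apply: eq_bigr => i _; ring.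
rewrite sE.
have A0 : 0 <= A by apply: sumr_ge0 => i _; exact: sqr_ge0.
have B0 : 0 <= B by apply: sumr_ge0 => i _; exact: sqr_ge0.
have S0 : 0 <= A + 2 * D + B.
  by rewrite -sE; apply: sumr_ge0 => i _; exact: sqr_ge0.
have := sqr_sqrtr A0; have := sqr_sqrtr B0; have := sqr_sqrtr S0.
have := sqrtr_ge0 A; have := sqrtr_ge0 B.
set p := Num.sqrt A; set q := Num.sqrt B => q0 p0 + qB pA e.
rewrite {}e => e.
(* Here [e] is the squared equality $(p+q)^2 = A + 2D + B$, with $A = p^2$ and $B = q^2$. *)
have De : D = p * q by apply: (mulfI (_ : 2 != 0)) => //; lra.
(* Equality in Cauchy-Schwarz: |t - u| (s - t) = |s - t| (t - u). *)
have /psumr_eq0P Z : \sum_(i < n)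
    (q * (s 0 i - t 0 i) - p * (t 0 i - u 0 i)) ^+ 2 = 0.
  transitivity (q ^+ 2 * A - 2 * p * q * D + p ^+ 2 * B).
    rewrite /A /B /D !mulr_sumr -sumrB -big_split /=.
    by apply: eq_bigr => i _; ring.
  by rewrite De -pA -qB; ring.
have {}Z i : q * (s 0 i - t 0 i) = p * (t 0 i - u 0 i).
  by apply/eqP; rewrite -subr_eq0 -sqrf_eq0 Z // => j _; exact: sqr_ge0.
have [pq0|pq0] := eqVneq (p + q) 0.
  have p00 : p = 0 by lra.
  exists 0; first by rewrite lexx ler01.
  rewrite scale0r addr0; apply/rowP => i; apply/esym/eqP.
  rewrite -subr_eq0 -sqrf_eq0; apply/eqP.
  have /psumr_eq0P -> // : A = 0 by rewrite -pA p00 expr0n.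
  by move=> j _; exact: sqr_ge0.
have pqp : 0 < p + q by rewrite lt_def pq0 addr_ge0.
(* The ratio of the distance from [s] to [t] to the distance from [s] to [u]. *)
exists (p / (p + q)).
  by rewrite divr_ge0 ?ler_pdivrMr ?mul1r ?lerDl ?addr_ge0.
apply/rowP => i; rewrite !mxE; apply: (mulfI pq0).
have -> : (p + q) * (s 0 i + p / (p + q) * (u 0 i - s 0 i)) =
  (p + q) * s 0 i + p * (u 0 i - s 0 i) by field.
by have := Z i; lra.
Qed.

Definition convex (R : realType) (V : lmodType R) (C : set V) : Prop :=
  forall x y r, C x -> C y -> 0 <= r <= 1 -> C (x + r *: (y - x)).

(** A combination of a point of $[x', a]$ and a point of $[y', a]$ puts some weight [r] on [a]; the
    remaining weight, renormalised, gives a point of $[x', y']$, which lies in the smaller hull by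
    induction. *)
Lemma convex_iter_hull (R : realType) n (c : 'rV[R]_n) l :
  convex (iter_hull (@ebetween R n) c l).
Proof.
elim: l => [|a l IH] x y s /=; first
  by move=> -> -> _; rewrite subrr scaler0 addr0.
move=> [x' [hx /ebetweenP[t /andP[t0 t1] ->]]].
move=> [y' [hy /ebetweenP[u /andP[u0 u1] ->]]] /andP[s0 s1].
pose r := (1 - s) * t + s * u.
have k1 : 0 <= (1 - s) * (1 - t) by rewrite mulr_ge0 // subr_ge0.
have k2 : 0 <= s * (1 - u) by rewrite mulr_ge0 // subr_ge0.
have k3 : 0 <= (1 - s) * t by rewrite mulr_ge0 // subr_ge0.
have k4 : 0 <= s * u by rewrite mulr_ge0.
have r0 : 0 <= r <= 1 by rewrite /r; apply/andP; split; nra.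
(* If [r] is 1, the weights $(1-s)(1-t)$ and $s(1-u)$ of [x'] and [y'] vanish and the combination is
   [a] itself. *)
have [r1|r1] := eqVneq r 1.
  exists x'; split=> //; apply/ebetweenP; exists 1; first by rewrite ler01 lexx.
  have e1 : (1 - s) * (1 - t) = 0 by move: r1; rewrite /r; nra.
  have e2 : s * (1 - u) = 0 by move: r1; rewrite /r; nra.
  apply/rowP => i; rewrite !mxE.
  transitivity (a 0 i + (1 - s) * (1 - t) * (x' 0 i - a 0 i)
    + s * (1 - u) * (y' 0 i - a 0 i)); first by ring.
  by rewrite e1 e2; ring.
have r1' : 1 - r != 0 by rewrite subr_eq0 eq_sym.
have r1p : 0 < 1 - r by case/andP: r0 => _; rewrite lt_def r1' subr_ge0.
exists (x' + (s * (1 - u) / (1 - r)) *: (y' - x')); split.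
  apply: IH => //; rewrite divr_ge0 ?(ltW r1p) //= ler_pdivrMr // mul1r /r.
  by lra.
apply/ebetweenP; exists r => //.
by apply/rowP => i; rewrite !mxE; move: r1'; rewrite /r => r1'; field.
Qed.

Lemma iter_hull_base (R : realType) n (c : 'rV[R]_n) l :
  iter_hull (@ebetween R n) c l c.
Proof.
elim: l => //= a l IH; exists c; split=> //; apply/ebetweenP.
by exists 0; rewrite ?lexx ?ler01 // scale0r addr0.
Qed.

Lemma iter_hull_mem (R : realType) n (c : 'rV[R]_n) l a :
  a \in l -> iter_hull (@ebetween R n) c l a.
Proof.
elim: l => //= b l IH; rewrite inE => /orP[/eqP ->|al].
  exists c; split; first exact: iter_hull_base.
  by apply/ebetweenP; exists 1; rewrite ?lexx ?ler01 // scale1r addrC subrK.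
exists a; split; first exact: IH.
by apply/ebetweenP; exists 0; rewrite ?lexx ?ler01 // scale0r addr0.
Qed.

(** With the three preceding lemmas, this identifies the iterated hull as the smallest convex set
    containing [c] and [l]. *)
Lemma iter_hull_min (R : realType) n (c : 'rV[R]_n) l (C : set 'rV[R]_n) :
  convex C -> C c -> {in l, forall a, C a} ->
  iter_hull (@ebetween R n) c l `<=` C.
Proof.
move=> cC Cc; elim: l => [_ x -> //|a l IH lC x [y [hy /ebetweenP[r r01 ->]]]].
apply: cC r01; last by apply: lC; rewrite mem_head.
by apply: IH hy => b bl; apply: lC; rewrite inE bl orbT.
Qed.

(** * Boxes around a point *)

Definition box (R : realType) n (c : 'rV[R]_n) (r : R) : set 'rV[R]_n :=
  [set x | forall i, `|x 0 i - c 0 i| <= r].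

Lemma convex_box (R : realType) n (c : 'rV[R]_n) r : convex (box c r).
Proof.
move=> x y s bx bz /andP[s0 s1] i; have := bx i; have := bz i.
rewrite !mxE !ler_norml => /andP[y1 y2] /andP[x1 x2].
by apply/andP; split; nra.
Qed.

Lemma compact_box (R : realType) n (c : 'rV[R]_n) r : compact (box c r).
Proof.
have -> : box c r = [set x | forall i, `[c 0 i - r, c 0 i + r] (x 0 i)].
  apply/seteqP; split=> x h i; have := h i;
  rewrite /= in_itv /= ler_norml; move=> /andP[]; lra.
apply: (@rV_compact R n (fun i => `[c 0 i - r, c 0 i + r]%classic)) => i.
exact: segment_compact.
Qed.

Lemma seq_sub_box (R : realType) n (c : 'rV[R]_n) (l : seq 'rV[R]_n) :
  exists2 r, 0 < r & {in l, forall a, box c r a}.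
Proof.
elim: l => [|a l [r r0 IH]]; first by exists 1.
have s0 : 0 <= \sum_i `|a 0 i - c 0 i| by apply: sumr_ge0.
exists (r + \sum_i `|a 0 i - c 0 i|) => [|b]; first exact: ltr_wpDr.
rewrite inE => /orP[/eqP ->|/IH h] i; last by have := h i; lra.
rewrite (bigD1 i) //= addrCA lerDl addr_ge0 ?(ltW r0) //.
exact: sumr_ge0.
Qed.

Lemma seq_box_isolated (R : realType) n (c : 'rV[R]_n) (l : seq 'rV[R]_n) :
  exists2 r, 0 < r & {in l, forall a, box c r a -> a = c}.
Proof.
elim: l => [|a l [r r0 IH]]; first by exists 1.
have [->|ac] := eqVneq a c.
  by exists r => // b; rewrite inE => /orP[/eqP//|]; exact: IH.
have [i aci] : exists i, a 0 i - c 0 i != 0.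
  apply/not_existsP => h; move/eqP: ac; apply; apply/rowP => i.
  by apply/eqP; rewrite -subr_eq0; apply/negPn/negP; exact: h.
have aci0 : 0 < `|a 0 i - c 0 i| by rewrite normr_gt0.
(* Halving leaves [a] strictly outside the closed box of radius [m]. *)
pose m := Num.min r (`|a 0 i - c 0 i| / 2).
have mr : m <= r by rewrite ge_min lexx.
have ma : m <= `|a 0 i - c 0 i| / 2 by rewrite ge_min lexx orbT.
exists m => [|b]; first by rewrite lt_min r0 divr_gt0.
rewrite inE => /orP[/eqP ->|bl] h; first by exfalso; have := h i; lra.
by apply: IH => // j; exact: le_trans (h j) mr.
Qed.

(** * Convex neighbourhoods *)

(** By induction: the average of [k.+2] points lies on the segment from the average of the first
    [k.+1] to the last one, at parameter $1/(k+2)$. *)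
Lemma convex_average (R : realType) (V : lmodType R) (C : set V) k
    (f : 'I_k.+1 -> V) :
  convex C -> (forall i, C (f i)) -> C (k.+1%:R^-1 *: \sum_i f i).
Proof.
move=> cC; elim: k f => [|k IH] f Cf.
  by rewrite big_ord1 invr1 scale1r.
have h := cC _ _ (k.+2%:R^-1) (IH _ (fun i => Cf (widen_ord (leqnSn _) i)))
  (Cf ord_max).
rewrite big_ord_recr /=.
have k0 : k.+2%:R != 0 :> R by rewrite pnatr_eq0.
have k1 : k.+1%:R != 0 :> R by rewrite pnatr_eq0.
set S := \sum_(i < k.+1) _ in h *.
suff -> : k.+2%:R^-1 *: (S + f ord_max) = k.+1%:R^-1 *: S
    + k.+2%:R^-1 *: (f ord_max - k.+1%:R^-1 *: S).
  by apply: h; rewrite invr_ge0 ler0n invf_le1 ?ltr0n // ler1n.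
rewrite scalerDr scalerBr addrA addrAC scalerA -[in RHS]scalerBl.
congr (_ *: _ + _); rewrite -natr1 in k0 *.
move: (k.+1%:R) k0 k1 => a k0 k1; field.
by rewrite k0 k1.
Qed.

(* x is the average of the n points c + n (x_i - c_i) e_i. *)
Lemma convex_average_axes (R : realType) n (c x : 'rV[R]_n) (C : set 'rV[R]_n) :
  (0 < n)%N -> convex C ->
  (forall i, C (c + (n%:R * (x 0 i - c 0 i)) *: delta_mx 0 i)) -> C x.
Proof.
case: n c x C => // k c x C _ cC h.
have := convex_average cC h; congr C.
have k1 : k.+1%:R != 0 :> R by rewrite pnatr_eq0.
apply/rowP => j; rewrite mxE summxE (eq_bigr (fun i => c 0 j +
  (if i == j then k.+1%:R * (x 0 i - c 0 i) else 0))); last first.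
  by move=> i _; rewrite !mxE eqxx /= eq_sym; case: eqP => /= _; ring.
rewrite big_split /= -big_mkcond big_pred1_eq sumr_const card_ord.
rewrite -[c 0 j *+ _]mulr_natl.
by rewrite -mulrDr addrC subrK mulKf.
Qed.

Lemma convex_line (R : realType) (V : lmodType R) (C : set V) c d (a b s : R) :
  convex C -> C (c + a *: d) -> C (c + b *: d) -> a < b -> a <= s <= b ->
  C (c + s *: d).
Proof.
move=> cC Ca Cb ab /andP[as_ sb].
have ba0 : 0 < b - a by rewrite subr_gt0.
have := cC _ _ ((s - a) / (b - a)) Ca Cb.
have -> : c + b *: d - (c + a *: d) = (b - a) *: d.
  by rewrite opprD addrACA subrr add0r scalerBl.
rewrite scalerA divfK ?gt_eqF // -addrA -scalerDl [a + _]addrC subrK.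
apply; rewrite divr_ge0 ?subr_ge0 ?(ltW ab) //= ler_pdivrMr // mul1r.
by rewrite lerD2r.
Qed.

(** [C] contains a segment around [c] on each of the finitely many axes. For [y] near [c], the axis
    points of [convex_average_axes] all lie on these segments, hence so does their average [y] in
    [C]. *)
Lemma convex_core_nbhs (R : realType) n (c : 'rV[R]_n) (C : set 'rV[R]_n) :
  (0 < n)%N -> convex C ->
  (forall y, y <> c -> exists z, [/\ z <> c, ebetween c z y & C z]) ->
  nbhs c C.
Proof.
move=> n0 cC coreC.
have n0R : 0 < n%:R :> R by rewrite ltr0n.
(* The hypothesis at [c + d] gives a point [c + t *: d] of [C], and [t] is positive because that
   point is not [c]. *)
have ray d : d != 0 -> exists2 t, 0 < t & C (c + t *: d).
  move=> d0; have [|z [zc /ebetweenP[t /andP[t0 _] et] Cz]] := coreC (c + d).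
    by move/eqP; rewrite -subr_eq0 [c + d]addrC addrK (negPf d0).
  move: et; rewrite [c + d]addrC addrK => et; exists t; last by rewrite -et.
  rewrite lt_def t0 andbT; apply/eqP => t00; apply: zc.
  by rewrite et t00 scale0r addr0.
have nearC i : \forall y \near c,
    C (c + (n%:R * ((y : 'rV[R]_n) 0 i - c 0 i)) *: delta_mx 0 i).
  have d0 : delta_mx 0 i != 0 :> 'rV[R]_n.
    apply/eqP => /rowP/(_ i); rewrite !mxE !eqxx => /eqP.
    by rewrite oner_eq0.
  have [t t0 Ct] := ray _ d0.
  have [u u0 Cu] : exists2 t, 0 < t & C (c + (- t) *: delta_mx 0 i).
    have [|u u0 Cu] := ray (- delta_mx 0 i); first by rewrite oppr_eq0.
    by exists u => //; rewrite scaleNr -scalerN.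
  pose m := Num.min t u.
  have mt : m <= t by rewrite ge_min lexx.
  have mu : m <= u by rewrite ge_min lexx orbT.
  have m0 : 0 < m by rewrite lt_min t0.
  (* The division by [n] compensates for the factor [n] in the axis points, so that their parameters
     stay within $[-m, m]$. *)
  apply/nbhs_ballP; exists (m / n%:R) => /=; first exact: divr_gt0.
  move=> y [_ /(_ 0 i)]; rewrite /ball /= distrC ltr_pdivlMr // => hy.
  apply: (convex_line cC Cu Ct); first by lra.
  have : `|n%:R * (y 0 i - c 0 i)| <= m.
    by rewrite normrM gtr0_norm // mulrC ltW.
  by rewrite ler_norml => /andP[h1 h2]; apply/andP; split; lra.
apply: filterS (filter_forall (nbhs_filter c) nearC) => y.
exact: convex_average_axes.
Qed.

(** The vertices of a cross-polytope centred at [c]. The next lemmas place their hull between the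
    boxes of radii $r/n$ and $r$. *)
Definition axis_points (R : realType) n (c : 'rV[R]_n) (r : R) :
    seq 'rV[R]_n :=
  [seq c + r *: delta_mx 0 i | i <- enum 'I_n] ++
  [seq c + (- r) *: delta_mx 0 i | i <- enum 'I_n].

Lemma size_axis_points (R : realType) n (c : 'rV[R]_n) r :
  size (axis_points c r) = (n + n)%N.
Proof. by rewrite size_cat !(size_map _ (enum _)) size_enum_ord. Qed.

Lemma hull_axis_points_sub (R : realType) n (c : 'rV[R]_n) r :
  0 <= r -> iter_hull (@ebetween R n) c (axis_points c r) `<=` box c r.
Proof.
move=> r0; apply: iter_hull_min; first exact: convex_box.
  by move=> i; rewrite subrr normr0.
have E j s : `|s| = r -> box c r (c + s *: delta_mx 0 j).
  move=> sr i; rewrite !mxE eqxx /= [c 0 i + _]addrC addrK normrM sr.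
  by case: (i == j); rewrite ?normr1 ?normr0 ?mulr1 ?mulr0.
move=> a; rewrite mem_cat => /orP[] /mapP[j _ ->]; apply: E.
  exact: ger0_norm.
by rewrite normrN ger0_norm.
Qed.

Lemma hull_axis_points_sup (R : realType) n (c : 'rV[R]_n) r :
  (0 < n)%N -> 0 < r ->
  box c (r / n%:R) `<=` iter_hull (@ebetween R n) c (axis_points c r).
Proof.
move=> n0 r0 x bx; have n0R : 0 < n%:R :> R by rewrite ltr0n.
have cH := convex_iter_hull (c := c) (l := axis_points c r).
apply: (convex_average_axes n0 cH) => i.
apply: (@convex_line R _ _ c (delta_mx 0 i) (- r) r _ cH); last 2 first.
- by lra.
- have := bx i; rewrite ler_pdivlMr // => h.
  by rewrite -ler_norml normrM (gtr0_norm n0R) mulrC.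
- apply: iter_hull_mem; rewrite mem_cat; apply/orP; right.
  by apply: map_f; rewrite mem_enum.
- apply: iter_hull_mem; rewrite mem_cat; apply/orP; left.
  by apply: map_f; rewrite mem_enum.
Qed.

(** * Compactness *)

(** If [P] were infinite, the sets containing all but finitely many points of [P] would form a
    proper filter containing [K]. At a cluster point [c] of it, every neighbourhood would meet [P]
    outside [c]. *)
Lemma compact_isolated_finite (T : topologicalType) (K P : set T) :
  compact K -> P `<=` K ->
  (forall c, exists2 U, nbhs c U & U `&` P `<=` [set c]) -> finite_set P.
Proof.
move=> cK PK iso; apply: contrapT => infP.
pose F : set (set T) := [set B | finite_set (P `\` B)].
have FF : ProperFilter F.
  split; first by rewrite /F /= setD0.
  split; first by rewrite /F /= setDT.
  - by move=> A B /= FA FB; rewrite /F /= setDIr finite_setU.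
  - by move=> A B AB; apply: sub_finite_set => x [Px nB]; split=> // /AB.
have [|c [_ clc]] := cK F FF.
  by move: PK; rewrite /F /= -setD_eq0 => ->.
have [U Uc UP] := iso c.
(* The set [P] without [c] is in the filter, since it misses at most one point of [P]. *)
have [|x [[Px xc] Ux]] := clc (P `\ c) U _ Uc; last exact/xc/UP.
apply: (@sub_finite_set _ _ [set c]) => // x [Px nx].
by apply: contrapT => xc; apply: nx.
Qed.

Local Close Scope classical_set_scope.
Local Close Scope ring_scope.

(** * The defining sentence *)

Theorem theorem3p3 (R : realType) (n : nat) (hn : (1 <= n)%N) :
  fo_definable (finite_expansions R n) (expansions R n).
Proof.
pose f := Fand (bounded_formula (n + n)) (isolated_formula (n + n)).
exists (universal_closure f); split; first exact: universal_closure_sentence.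
move=> _ [P ->]; rewrite models_universal_closure.
have n0R : (0 < n%:R :> R)%R by rewrite ltr0n.
split=> [[_ /finite_seqP[s Ps]] v|sat_f].
  split; [apply/sat_bounded_formula|apply/sat_isolated_formula => c].
    have [r r0 sr] := seq_sub_box 0%R s.
    (* Scaling by [n] makes the hull contain the box of radius [r], and thus all of [P]. *)
    exists 0%R, (axis_points 0 (r * n%:R))%R.
    rewrite size_axis_points; split=> // y; rewrite Ps => ys.
    apply: hull_axis_points_sup => //; first exact: mulr_gt0.
    by rewrite mulfK ?gt_eqF //; exact: sr.
  have [r r0 sr] := seq_box_isolated c s.
  exists (axis_points c r); split; first exact: size_axis_points.
    move=> y yc; have [K K0 yK] := seq_sub_box c [:: y].
    (* Since [K] bounds the coordinates of [y - c], this [t] brings [c + t *: (y - c)] into the box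
       of radius $r/n$, while the bound 1 keeps it on the segment. *)
    pose t := Num.min 1%R (r / n%:R / K)%R.
    have t0 : (0 < t)%R by rewrite lt_min ltr01 !divr_gt0.
    have t1 : (t <= 1)%R by rewrite ge_min lexx.
    have tK : (t * K <= r / n%:R)%R.
      by rewrite -ler_pdivlMr // ge_min lexx orbT.
    exists (c + t *: (y - c))%R; split.
    - move/eqP; rewrite -subr_eq0 [(c + _)%R]addrC addrK scaler_eq0.
      by rewrite gt_eqF // subr_eq0 => /eqP.
    - by apply/ebetweenP; exists t => //; rewrite ltW.
    - apply: hull_axis_points_sup => // i.
      have := yK y (mem_head _ _) i; rewrite !mxE => yi.
      rewrite [(c 0 i + _)%R]addrC addrK normrM gtr0_norm //.
      by apply: le_trans tK; rewrite ler_pM2l.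
  move=> y; rewrite Ps => ys /(hull_axis_points_sub (ltW r0)).
  exact: sr.
split; first by exists P.
(* Any valuation serves here; the constant zero one is taken. *)
have [/sat_bounded_formula[c [l [_ Pl]]] /sat_isolated_formula iso] :=
  sat_f (fun=> 0%R).
have [K K0 lK] := seq_sub_box c l.
apply: (compact_isolated_finite (compact_box (c := c) (r := K))) => [y /Pl|a].
  apply: iter_hull_min => //; first exact: convex_box.
  by move=> i; rewrite subrr normr0 ltW.
have [l' [_ core isoP]] := iso a.
exists (iter_hull (@ebetween R n) a l') => [|y [hy Py]]; last exact: isoP.
by apply: convex_core_nbhs => //; exact: convex_iter_hull.
Qed.
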